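(* Let $N$ be an odd positive integer and $k \ge 1$. If $k$ is odd and $\gcd\!\left(\frac{\pi_N(k+1)}{\pi_N(k)}, N\right) > 1$, then \[ \frac{\pi_N(k+1)}{\pi_N(k)} \sum_{i=0}^{\pi_N(k)-1} p_{\le k}(i) \equiv 0 \pmod{N}. \] Otherwise, $\sum_{i=0}^{\pi_N(k)-1} p_{\le k}(i) \equiv 0 \pmod{N}$.
   Context: $p_{\le k}(n)$ denotes the number of partitions of $n$ with at most $k$ parts. For a modulus $N$, $(p_{\le k}(n)\bmod N)_{n\ge 0}$ is purely periodic and $\pi_N(k)$ denotes its minimal period; $\pi_N(k)$ divides $\pi_N(k+1)$. *)

(* Defs.v *)
From mathcomp Require Import all_boot.
From mathcomp Require Import boolp classical_sets.

Set Implicit Arguments.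
Unset Strict Implicit.
Unset Printing Implicit Defensive.

Definition is_partition (n : nat) (s : seq nat) : bool :=
  [&& sorted geq s, 0 \notin s & sumn s == n].

(* Parts of a partition of n are at most n, so tuples over 'I_n.+1 are enough. *)
Definition partitions_with (j n : nat) : {set j.-tuple 'I_n.+1} :=
  [set t : j.-tuple 'I_n.+1 | is_partition n (map val t)].

Definition p_le (k n : nat) : nat := \sum_(j < k.+1) #|partitions_with j n|.

Definition is_period (u : nat -> nat) (d : nat) : Prop :=
  0 < d /\ forall n, u (n + d) = u n.

Definition is_minimal_period (u : nat -> nat) (d : nat) : Prop :=
  is_period u d /\ forall e, is_period u e -> d <= e.

(* The default 0 would only be taken if the sequence had no period, which does
   not happen for N > 0. *)
Definition min_period (N k : nat) : nat :=
  xget 0 [set d | is_minimal_period (fun n => p_le k n %% N) d]%classic.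

(* Main.v *)
(* Let A be the generating polynomial of one period of p_{<=k} modulo N, of
   length d, so that A(1) is the sum to be computed.  Modulo N one has
   A * prod_(i = 1..k) (1 - X^i) = 1 - X^d.  Reversing the coefficients of both
   sides gives X^t A = (-1)^(k+1) A^rev with t = k(k+1)/2, hence A(1) = - A(1)
   for even k, and N is odd.  For any k, summing
   p_{<=k+1}(n) - p_{<=k+1}(n - k - 1) = p_{<=k}(n) over a period of p_{<=k+1}
   telescopes, so that pi_N(k+1) / pi_N(k) times the sum vanishes modulo N; the
   quotient can be cancelled when it is coprime to N. *)

Require Import Defs.
From mathcomp Require Import all_boot.
From mathcomp Require Import all_algebra.
From mathcomp Require Import boolp classical_sets.
Import GRing.Theory.

Set Implicit Arguments.
Unset Strict Implicit.
Unset Printing Implicit Defensive.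

(** * Partitions as words of natural numbers, and the recurrence for [p_le] *)

Section Tuples.
Variables (j n : nat) (P : pred (seq nat)).

(* The words underlying the tuples: their type no longer depends on n, so those
   for different n can be compared. *)
Definition tuple_words : seq (seq nat) :=
  [seq map val (tval t) | t <- enum [set t : j.-tuple 'I_n.+1 | P (map val t)]].

Lemma tuple_words_uniq : uniq tuple_words.
Proof.
rewrite map_inj_uniq ?enum_uniq // => t1 t2 /= /(inj_map val_inj) e.
exact: val_inj.
Qed.

Lemma mem_tuple_words s :
  (s \in tuple_words) = [&& size s == j, all (fun x => x <= n) s & P s].
Proof.
apply/mapP/and3P => [[t]|[/eqP sz le_n Ps]].
  rewrite mem_enum inE => Pt ->; split=> //; first by rewrite size_map size_tuple.
  apply/allP => _ /mapP[i _ ->]; exact: (ltn_ord i).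
have e : map val (map (@inord n) s) = s.
  rewrite -map_comp map_id_in // => x /(allP le_n) /= le_x.
  by rewrite inordK.
have sz' : size (map (@inord n) s) == j by rewrite size_map sz.
by exists (Tuple sz'); rewrite ?mem_enum ?inE /= e.
Qed.

Lemma size_tuple_words :
  size tuple_words = #|[set t : j.-tuple 'I_n.+1 | P (map val t)]|.
Proof. by rewrite size_map cardE. Qed.

End Tuples.

(* Zeros are allowed: a word of length j encodes, after padding, a partition into
   at most j parts. *)
Definition weakly_decreasing (n : nat) (s : seq nat) : bool :=
  sorted geq s && (sumn s == n).

Lemma all_leq_sumn (s : seq nat) : all (fun x => x <= sumn s) s.
Proof.
apply/allP => x; elim: s => //= a s IH; rewrite inE => /orP[/eqP->|/IH le].
  exact: leq_addr.
exact: leq_trans le (leq_addl _ _).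
Qed.

Lemma mem_weakly_decreasing j n s :
  (s \in tuple_words j n (weakly_decreasing n)) =
  [&& size s == j, sorted geq s & sumn s == n].
Proof.
rewrite mem_tuple_words /weakly_decreasing; case: eqP => //= _.
case: (sorted _ _); rewrite ?andbF //=; case: eqP; rewrite ?andbF // => <-.
by rewrite all_leq_sumn.
Qed.

Lemma mem_partitions j n s :
  (s \in tuple_words j n (is_partition n)) =
  [&& size s == j, sorted geq s, 0 \notin s & sumn s == n].
Proof.
rewrite mem_tuple_words /is_partition; case: eqP => //= _.
case: (sorted _ _); rewrite ?andbF //=; case: (0 \in s); rewrite ?andbF //=.
by case: eqP; rewrite ?andbF // => <-; rewrite all_leq_sumn.
Qed.

Lemma sorted_geq_rcons0 s : sorted geq (rcons s 0) = sorted geq s.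
Proof.
by elim: s => // a [|b s] //= ->.
Qed.

Lemma sumn_map_succ s : sumn (map succn s) = sumn s + size s.
Proof. by elim: s => //= a s ->; rewrite addSn !addnS addnA. Qed.

Lemma sorted_map_succ s : sorted geq (map succn s) = sorted geq s.
Proof. by elim: s => // a [|b s] //= ->. Qed.

(** No entry of a weakly decreasing word is below the last one, so a zero anywhere forces the last
    entry to be zero. *)
Lemma sorted_rcons0 s :
  sorted geq s -> 0 \in s -> s = rcons (take (size s).-1 s) 0.
Proof.
case/lastP: s => // s x; rewrite size_rcons /= -cats1 take_cat ltnn subnn cats0.
have geqt : transitive geq by move=> a b c /= h1 h2; exact: leq_trans h2 h1.
rewrite cats1 mem_rcons inE => srt /orP[/eqP<- //|s0].
suff: x <= 0 by rewrite leqn0 => /eqP ->.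
move: srt; rewrite (sorted_pairwise geqt) pairwise_rcons => /andP[/allP h _].
exact: h s0.
Qed.

Lemma weakly_decreasing_split k n :
  perm_eq (tuple_words k.+1 n (weakly_decreasing n))
    (map (rcons^~ 0) (tuple_words k n (weakly_decreasing n))
      ++ tuple_words k.+1 n (is_partition n)).
Proof.
apply: uniq_perm; rewrite ?tuple_words_uniq //.
  rewrite cat_uniq !tuple_words_uniq andbT map_inj_uniq ?tuple_words_uniq /=.
    apply/hasPn => s; rewrite mem_partitions => /and4P[_ _ s0 _].
    by apply/mapP => -[t _ e]; rewrite e mem_rcons inE eqxx in s0.
  by move=> s t /rcons_inj[].
move=> s; rewrite mem_cat mem_partitions mem_weakly_decreasing.
have [s0|s0] := boolP (0 \in s); last first.
  rewrite [X in _ = X || _](_ : _ = false) //.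
  by apply/mapP => -[t _ e]; rewrite e mem_rcons inE eqxx in s0.
rewrite /= !andbF orbF; apply/and3P/mapP => [[/eqP sz srt /eqP sm]|[t]].
  have e := sorted_rcons0 srt s0; exists (take (size s).-1 s) => //.
  rewrite mem_weakly_decreasing -sorted_geq_rcons0 -e srt.
  by rewrite size_take sz ltnSn eqxx -sm [in X in _ == X]e sumn_rcons addn0 sz eqxx.
rewrite mem_weakly_decreasing => /and3P[/eqP sz srt /eqP sm] ->.
by rewrite size_rcons sz sorted_geq_rcons0 srt sumn_rcons sm addn0 !eqxx.
Qed.

(** Subtracting 1 from each of the [k] positive parts is a bijection onto words that may contain
    zeros. *)
Lemma partitions_shift k n :
  perm_eq (tuple_words k (n + k) (is_partition (n + k)))
    (map (map succn) (tuple_words k n (weakly_decreasing n))).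
Proof.
apply: uniq_perm; rewrite ?tuple_words_uniq //.
  by rewrite map_inj_uniq ?tuple_words_uniq //; apply: inj_map => x y [].
move=> s; rewrite mem_partitions; apply/and4P/mapP => [[/eqP sz srt s0 /eqP sm]|[t]].
  have e : s = map succn (map predn s).
    rewrite -map_comp map_id_in // => -[|x] //= x0.
    by rewrite x0 in s0.
  exists (map predn s) => //; rewrite mem_weakly_decreasing size_map sz eqxx.
  rewrite -sorted_map_succ -e srt /= -(eqn_add2r k) -sm [in X in _ == X]e.
  by rewrite sumn_map_succ size_map sz.
rewrite mem_weakly_decreasing => /and3P[/eqP sz srt /eqP sm] ->.
rewrite size_map sz sorted_map_succ srt sumn_map_succ sm sz !eqxx; split=> //.
by apply/mapP => -[].
Qed.

Lemma p_le_words k n : p_le k n = size (tuple_words k n (weakly_decreasing n)).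
Proof.
elim: k => [|k IH]; rewrite /p_le big_ord_recr /= -size_tuple_words.
  rewrite big_ord0; apply/perm_size/uniq_perm; rewrite ?tuple_words_uniq // => s.
  by rewrite mem_partitions mem_weakly_decreasing; case: s.
rewrite (perm_size (weakly_decreasing_split k n)) size_cat.
by rewrite (size_map (rcons^~ 0)) -IH.
Qed.

Lemma p_le_recr k n :
  p_le k.+1 n = p_le k n + (if n < k.+1 then 0 else p_le k.+1 (n - k.+1)).
Proof.
rewrite !p_le_words (perm_size (weakly_decreasing_split k n)) size_cat.
rewrite (size_map (rcons^~ 0)).
congr (_ + _); case: ltnP => [lt_nk|le_kn].
  (* [k.+1] positive parts add up to at least [k.+1], so no such partition of [n] exists. *)
  apply/eqP; rewrite size_eq0; apply/negPn/negP.
  case E: (tuple_words _ _ _) => [|s l] // _.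
  have: s \in tuple_words k.+1 n (is_partition n) by rewrite E mem_head.
  rewrite mem_partitions => /and4P[/eqP sz _ s0 /eqP sm].
  suff: size s <= sumn s by rewrite sz sm leqNgt lt_nk.
  elim: s s0 {E sz sm} => //= -[|a] s IH; rewrite inE ?eqxx //= => /IH h.
  by rewrite addSn ltnS (leq_trans h) ?leq_addl.
have /perm_size := partitions_shift k.+1 (n - k.+1).
by rewrite subnK // (size_map (map succn)) => ->.
Qed.

Lemma p_leS k n : p_le k.+1 (n + k.+1) = p_le k (n + k.+1) + p_le k.+1 n.
Proof. by rewrite p_le_recr ltnNge leq_addl /= addnK. Qed.

Lemma p_le0 n : p_le 0 n = (n == 0).
Proof.
rewrite p_le_words; have [->|n0] := eqVneq n 0.
  transitivity (size [:: ([::] : seq nat)]) => //.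
  apply/perm_size/uniq_perm; rewrite ?tuple_words_uniq // => s.
  by rewrite mem_weakly_decreasing inE; case: s.
apply/eqP; rewrite size_eq0; case E: (tuple_words _ _ _) => [|s l] //.
have: s \in tuple_words 0 n (weakly_decreasing n) by rewrite E mem_head.
by rewrite mem_weakly_decreasing; case: s {E} => //= /eqP e; rewrite -e in n0.
Qed.

Lemma p_le1 n : p_le 1 n = 1.
Proof.
elim: n => [|n IH]; first by rewrite p_le_recr p_le0.
by rewrite p_le_recr p_le0 /= subn1.
Qed.

(** * Periods of sequences and sums over a period *)

Lemma is_period_mul u d m n : is_period u d -> u (n + m * d) = u n.
Proof.
move=> [_ per]; elim: m => [|m IH]; first by rewrite ?mul0n !addn0.
by rewrite mulSnr addnA per.
Qed.

(** Passing from [a] to [a.+1] drops the first term and appends one that equals it by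
    periodicity. *)
Lemma sum_period_shift f d a :
  is_period f d -> \sum_(0 <= i < d) f (i + a) = \sum_(0 <= i < d) f i.
Proof.
move=> [d_gt0 per]; elim: a => [|a IH]; first by apply: eq_bigr => i _; rewrite addn0.
have e : d.-1 + a.+1 = a + d by rewrite addnS -addSn prednK // addnC.
rewrite -IH -(prednK d_gt0) big_nat_recr // [RHS]big_nat_recl //= e per add0n.
rewrite addnC; congr (_ + _).
by apply: eq_bigr => i _; rewrite addnS addSn.
Qed.

Lemma sum_period_mul f d m :
  is_period f d -> \sum_(0 <= i < m * d) f i = m * \sum_(0 <= i < d) f i.
Proof.
move=> per; elim: m => [|m IH]; first by rewrite !mul0n big_geq.
rewrite mulSnr (@big_cat_nat _ _ _ (m * d)) ?leq_addr //= IH mulSnr.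
rewrite -{1}[m * d]add0n big_addn addKn; congr (_ + _).
by apply: eq_bigr => i _; rewrite is_period_mul.
Qed.

(** A nonzero remainder of [e] modulo [d] would be a period smaller than [d]. *)
Lemma minimal_period_dvdn u d e :
  is_minimal_period u d -> is_period u e -> d %| e.
Proof.
move=> [[d_gt0 per] min_d] [e_gt0 pere].
have [r0|r_gt0] := posnP (e %% d); first by rewrite /dvdn r0.
have /min_d : is_period u (e %% d).
  split=> // n; rewrite -(@is_period_mul u d (e %/ d)) //.
  by rewrite -addnA [_ %% _ + _]addnC -divn_eq pere.
by rewrite leqNgt ltn_mod d_gt0.
Qed.

Lemma ex_minimal_period u d : is_period u d -> exists e, is_minimal_period u e.
Proof.
move=> per; have ex : exists e, `[< is_period u e >] by exists d; apply/asboolP.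
exists (ex_minn ex); case: ex_minnP => e /asboolP pere min_e; split=> // f perf.
by apply: min_e; apply/asboolP.
Qed.

(** * Periodicity modulo [N], and the telescoping sum *)

Section Residues.
Variables (N : nat) (N_gt0 : 0 < N).

Local Notation residue k := (fun n => p_le k n %% N).

Lemma p_le_iter k m n :
  p_le k.+1 (n + m * k.+1) = p_le k.+1 n + \sum_(j < m) p_le k (n + j.+1 * k.+1).
Proof.
elim: m => [|m IH]; first by rewrite big_ord0 !addn0.
by rewrite big_ord_recr /= mulSnr addnA p_leS -addnA -mulSnr IH addnC addnA.
Qed.

(** Induction on [k]. The step [b] is a multiple of the old period [d] and consists of [d] jumps of
    length [k.+2]. Each advance by [b] thus adds the same amount modulo [N], and [N] advances add
    zero. *)
Lemma p_le_periodic k : exists d, is_period (residue k.+1) d.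
Proof.
elim: k => [|k [d [d_gt0 per]]]; first by exists 1; split=> // n; rewrite !p_le1.
set b := d * k.+2.
have perb n i : p_le k.+1 (n + i * b) = p_le k.+1 n %[mod N].
  rewrite (_ : i * b = i * k.+2 * d); last by rewrite /b mulnCA mulnC.
  exact: (@is_period_mul (residue k.+1) d).
exists (N * b); split=> [|n]; first by rewrite !muln_gt0 N_gt0 d_gt0.
have step t : p_le k.+2 (n + t * b) =
    p_le k.+2 n + t * \sum_(j < d) p_le k.+1 (n + j.+1 * k.+2) %[mod N].
  elim: t => [|t IH]; first by rewrite ?mul0n !addn0.
  rewrite mulSnr addnA /b p_le_iter -/b -modnDml IH modnDml mulSnr addnA.
  apply/eqP; rewrite eqn_modDl -modn_summ -[X in _ == X]modn_summ; apply/eqP.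
  congr (_ %% N); apply: eq_bigr => j _.
  by rewrite addnAC perb.
by rewrite step -modnDmr modnMr addn0.
Qed.

Lemma min_periodP k : is_minimal_period (residue k.+1) (min_period N k.+1).
Proof.
have [d per] := p_le_periodic k; have [e min_e] := ex_minimal_period per.
apply: (@xgetPex _ 0 [set d | is_minimal_period (residue k.+1) d]%classic).
by exists e.
Qed.

(** The recurrence writes [p_le k.+1] as a difference of two values of [p_le k.+2], both of which
    have period [e] modulo [N]. *)
Lemma period_p_le_pred k e :
  is_period (residue k.+2) e -> is_period (residue k.+1) e.
Proof.
move=> [e_gt0 pere]; split=> // n; have [[d_gt0 perd] _] := min_periodP k.
set d := min_period _ _ in d_gt0 perd.
have le : k.+2 <= k.+2 * d by rewrite leq_pmulr.
(* Adding [k.+2] periods [d] brings both arguments to at least [k.+2], where [p_leS] applies. *)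
rewrite -(@is_period_mul (residue k.+1) d k.+2) //.
rewrite -[RHS](@is_period_mul (residue k.+1) d k.+2) //.
rewrite -(subnK le) !addnA; set m := _ * d - _; apply/eqP.
rewrite -(eqn_modDr (p_le k.+2 (n + m))) -p_leS (addnAC n e).
by rewrite -modnDmr -pere modnDmr -p_leS addnAC pere.
Qed.

Lemma min_period_dvdn k : min_period N k.+1 %| min_period N k.+2.
Proof.
apply: minimal_period_dvdn (min_periodP k) _; apply: period_p_le_pred.
by have [] := min_periodP k.+1.
Qed.

Lemma quot_mul_sum_period k :
  (min_period N k.+2 %/ min_period N k.+1) *
    \sum_(0 <= i < min_period N k.+1) p_le k.+1 i = 0 %[mod N].
Proof.
set d := min_period N k.+1; set e := min_period N k.+2.
have [perd _] : is_minimal_period (residue k.+1) d := min_periodP k.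
have [pere _] : is_minimal_period (residue k.+2) e := min_periodP k.+1.
have pere' := period_p_le_pred pere.
rewrite -modnMmr -modn_summ modnMmr -sum_period_mul // divnK ?min_period_dvdn //.
(* The shift by [k.+2] puts every term in the range of [p_leS]. After adding the sum of [p_le k.+2]
   to both sides, they are two sums over one period [e]. *)
rewrite -(sum_period_shift k.+2 pere') modn_summ; apply/eqP.
rewrite -(eqn_modDr (\sum_(0 <= i < e) p_le k.+2 i)) -big_split /= add0n.
under eq_bigr do rewrite -p_leS.
by rewrite -modn_summ (sum_period_shift k.+2 pere) modn_summ.
Qed.

End Residues.

(** * Reversal of polynomials *)

Section Reversal.
Local Open Scope ring_scope.
Variable R : comNzRingType.
Implicit Types (p q : {poly R}) (m n : nat).

(** The formal degree [m] is prescribed instead of read off from [p], which keeps reversal linear,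
    and multiplicative even when [R] has zero divisors. *)
Definition rev_poly m p : {poly R} := \sum_(i < m.+1) p`_i *: 'X^(m - i).

(** Both sides are bilinear, which reduces the claim to monomials. *)
Lemma rev_polyM m n p q :
  (size p <= m.+1)%N -> (size q <= n.+1)%N ->
  rev_poly (m + n) (p * q) = rev_poly m p * rev_poly n q.
Proof.
move=> sp sq.
have revD N : {morph rev_poly N : f g / f + g}.
  move=> f g; rewrite -big_split; apply: eq_bigr => i _.
  by rewrite coefD scalerDl.
have rev0 N : rev_poly N 0 = 0.
  by apply: big1 => i _; rewrite coef0 scale0r.
have revZ N c f : rev_poly N (c *: f) = c *: rev_poly N f.
  by rewrite scaler_sumr; apply: eq_bigr => i _; rewrite coefZ scalerA.
have revXn N k : (k <= N)%N -> rev_poly N 'X^k = 'X^(N - k).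
  move=> le_kN; rewrite /rev_poly (bigD1 (inord k)) //= inordK ?ltnS //.
  rewrite coefXn eqxx scale1r big1 ?addr0 // => i.
  by rewrite -val_eqE /= inordK ?ltnS // coefXn => /negPf->; rewrite scale0r.
have expand N (f : {poly R}) : (size f <= N.+1)%N -> f = \sum_(i < N.+1) f`_i *: 'X^i.
  move=> le; rewrite -poly_def; apply/polyP => i; rewrite coef_poly.
  by case: ltnP => // le'; rewrite nth_default // (leq_trans le).
rewrite {1}(expand _ _ sp) {1}(expand _ _ sq) mulr_suml.
rewrite (big_morph _ (revD _) (rev0 _)).
rewrite [in RHS]/rev_poly mulr_suml; apply: eq_bigr => i _.
rewrite !mulr_sumr (big_morph _ (revD _) (rev0 _)); apply: eq_bigr => j _.
rewrite -!scalerAl -!scalerAr !revZ -!exprD revXn; last first.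
  by rewrite leq_add // -ltnS.
congr (_ *: (_ *: 'X^_)).
have := ltn_ord i; have := ltn_ord j; rewrite !ltnS => lej lei.
by rewrite subnDA -addnBAC // addnBA.
Qed.

Lemma horner1_rev_poly m p : (size p <= m.+1)%N -> (rev_poly m p).[1] = p.[1].
Proof.
move=> sp; rewrite horner_sum (horner_coef_wide 1 sp).
by apply: eq_bigr => i _; rewrite hornerZ hornerXn !expr1n.
Qed.

Lemma rev_poly_1subXn d : (0 < d)%N -> rev_poly d (1 - 'X^d) = 'X^d - 1 :> {poly R}.
Proof.
case: d => // d _; rewrite /rev_poly big_ord_recl big_ord_recr /= big1 => [|i _].
  rewrite !coefB !coef1 !coefXn /= eqxx subr0 scale1r sub0r scaleN1r.
  by rewrite subn0 subnn add0r expr0.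
rewrite coefB coef1 coefXn /= /bump /= add1n eqSS ltn_eqF // subrr.
by rewrite scale0r.
Qed.

(** Write [p] as [1 * p]: the reversal of 1 at formal degree [m] is ['X^m]. *)
Lemma rev_poly_wide m n p :
  (size p <= n.+1)%N -> rev_poly (m + n) p = 'X^m * rev_poly n p.
Proof.
move=> sp; rewrite -[p in LHS]mul1r rev_polyM ?size_poly1 //; congr (_ * _).
rewrite /rev_poly big_ord_recl /= big1 => [|i _].
  by rewrite coef1 scale1r addr0 subn0.
by rewrite coef1 /= scale0r.
Qed.

(** The q-Pochhammer symbol (X; X)_k, inverse to the generating series of [p_le k]. Its degree is
    the triangular number [tri k]. *)
Fixpoint qfact k : {poly R} := if k is j.+1 then qfact j * (1 - 'X^k) else 1.
Fixpoint tri k : nat := if k is j.+1 then (tri j + k)%N else 0%N.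

Lemma size_1subXn d : (size (1 - 'X^d : {poly R})%R <= d.+1)%N.
Proof.
apply: leq_trans (size_polyD _ _) _.
by rewrite size_polyN size_polyXn size_poly1 geq_max leqnn.
Qed.

Lemma size_qfact k : (size (qfact k) <= (tri k).+1)%N.
Proof.
elim: k => [|k IH]; first by rewrite size_poly1.
apply: leq_trans (size_polyMleq _ _) _ => /=.
have := leq_add IH (size_1subXn k.+1).
by rewrite addSn addnS; case: (_ + _)%N.
Qed.

Lemma rev_qfact k : rev_poly (tri k) (qfact k) = (-1) ^+ k * qfact k.
Proof.
elim: k => [|k IH].
  by rewrite /rev_poly big_ord1 /= coef1 scale1r mulr1.
rewrite /= rev_polyM ?size_qfact ?size_1subXn // IH rev_poly_1subXn //.
by rewrite -[_ - 1]opprB (exprS (-1)) mulN1r mulrN mulNr mulrA.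
Qed.

(** Each factor is the opposite of a monic polynomial, so it can be cancelled even over a ring with
    zero divisors. *)
Lemma lreg_qfact k : GRing.lreg (qfact k).
Proof.
elim: k => [|k IH]; first exact: lreg1.
apply: lregM => //; rewrite -opprB; apply: lregN; apply: monic_lreg.
exact: monicXnsubC.
Qed.

(* Since qfact k is its own reversal for even k, reversing the hypothesis gives
   [X^t * p = - rev_poly d p] with [t = tri k]. *)
Lemma horner1_cofactor k d p :
    ~~ odd k -> (0 < d)%N -> (size p <= d.+1)%N ->
  qfact k * p = 1 - 'X^d -> p.[1] *+ 2 = 0.
Proof.
move=> k_even d_gt0 sp e.
have := rev_polyM (size_qfact k) sp.
rewrite e rev_poly_wide ?size_1subXn // rev_poly_1subXn // rev_qfact.
rewrite -signr_odd (negPf k_even) expr0 mul1r -opprB -e mulrN mulrCA -mulrN.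
move/lreg_qfact/(congr1 (horner^~ 1)).
rewrite hornerN hornerM hornerXn expr1n mul1r horner1_rev_poly // => h.
by rewrite mulr2n -[X in X + _]opprK h addNr.
Qed.

End Reversal.

(** * Truncated generating polynomials of [p_le] *)

Section Generating.
Local Open Scope ring_scope.
Variable R : comNzRingType.

Definition gen k m : {poly R} := \poly_(i < m) (p_le k i)%:R.

(** This is [p_le_recr] read on coefficients below [m]; [q] collects what truncation leaves
    above. *)
Lemma gen_step k m :
  exists q : {poly R}, (1 - 'X^(k.+1)) * gen k.+1 m = gen k m + q * 'X^m.
Proof.
exists (drop_poly m ((1 - 'X^(k.+1)) * gen k.+1 m)).
rewrite -{1}[LHS](poly_take_drop m); congr (_ + _); apply/polyP => i.
rewrite coef_take_poly coef_poly; case: ltnP => // lt_im.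
rewrite mulrBl mul1r coefB coefXnM !coef_poly lt_im p_le_recr natrD.
case: ltnP => [_|le]; first by rewrite addr0 subr0.
by rewrite (leq_ltn_trans (leq_subr _ _) lt_im) addrK.
Qed.

Lemma qfact_gen k m : exists q : {poly R}, qfact R k * gen k m = 1 + q * 'X^m.
Proof.
elim: k => [|k [q IH]]; last first.
  have [r e] := gen_step k m; exists (q + qfact R k * r).
  by rewrite /= -mulrA e mulrDr IH mulrA mulrDl addrA.
case: m => [|m].
  exists (-1); rewrite mul1r mulN1r expr0 subrr; apply/polyP => i.
  by rewrite coef_poly coef0.
exists 0; rewrite mul1r mul0r addr0; apply/polyP => i.
by rewrite coef_poly p_le0 coef1; case: i => //= i; case: ifP.
Qed.

Lemma gen_periodic k d m :
  (forall n, (p_le k (n + d))%:R = (p_le k n)%:R :> R) ->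
  gen k (m * d) * (1 - 'X^d) = gen k d * (1 - 'X^(m * d)).
Proof.
move=> per; have cat l : gen k (l + d) = gen k d + gen k l * 'X^d.
  apply/polyP => i; rewrite coefD coefMXn !coef_poly.
  case: (ltnP i d) => [lt_id|le_di]; first by rewrite addr0 ltn_addl.
  rewrite add0r -[in LHS](subnK le_di) per ltn_add2r.
  by case: ltnP.
elim: m => [|m IH].
  rewrite mul0n expr0 subrr mulr0 (_ : gen k 0 = 0) ?mul0r //.
  by apply/polyP => i; rewrite coef_poly coef0.
rewrite mulSnr cat mulrDl mulrAC IH -mulrA -mulrDr; congr (_ * _).
by rewrite mulrBl mul1r -exprD addrA subrK.
Qed.

(** The difference [p] of the two sides is divisible by ['X^(m * d)] for every [m]. Taking for [m]
    the size of [p] forces [p] to vanish. *)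
Lemma qfact_gen_period k d :
  (0 < d)%N -> (forall n, (p_le k (n + d))%:R = (p_le k n)%:R :> R) ->
  qfact R k * gen k d = 1 - 'X^d.
Proof.
move=> d_gt0 per; apply/eqP; rewrite -subr_eq0; apply/eqP.
set p := _ - _; set m := size p.
have [q e] := qfact_gen k (m * d).
have e2 : p = (qfact R k * gen k d + q * (1 - 'X^d)) * 'X^(m * d).
  have h : qfact R k * gen k d * (1 - 'X^(m * d)) =
      (1 - 'X^d) + q * 'X^(m * d) * (1 - 'X^d).
    by rewrite -[LHS]mulrA -gen_periodic // mulrA e mulrDl mul1r.
  apply/eqP; rewrite subr_eq mulrDl -addrA [q * _ * _]mulrAC [_ + (1 - _)]addrC -h.
  by rewrite -mulrDr addrC subrK mulr1.
apply/polyP => i; rewrite coef0; have [lt_i|] := ltnP i m; last exact: nth_default.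
by rewrite e2 coefMXn (leq_trans lt_i) // leq_pmulr.
Qed.

End Generating.

(** * Sums over a minimal period for odd [N] *)

Lemma sum_period_even N k :
  odd N -> ~~ odd k.+1 ->
  \sum_(0 <= i < min_period N k.+1) p_le k.+1 i = 0 %[mod N].
Proof.
move=> N_odd k_even; have N_gt0 := odd_gt0 N_odd.
have [[d_gt0 per] _] := min_periodP N_gt0 k.
move: (min_period _ _) d_gt0 per => d d_gt0 per.
(* ['Z_N] is the ring of integers modulo [N] only when [N] exceeds 1, so [N = 1] is treated
   apart. *)
have [N_le1|N_gt1] := leqP N 1.
  have -> : N = 1 by apply/eqP; rewrite eqn_leq N_le1.
  by rewrite !modn1.
have perR n : ((p_le k.+1 (n + d))%:R = (p_le k.+1 n)%:R :> 'Z_N)%R.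
  by rewrite -Zp_nat_mod // per Zp_nat_mod.
have sz : size (gen 'Z_N k.+1 d) <= d.+1 by rewrite (leq_trans (size_poly _ _)).
have := horner1_cofactor k_even d_gt0 sz (qfact_gen_period d_gt0 perR).
rewrite horner_poly (eq_bigr (fun i : 'I_d => (p_le k.+1 i)%:R%R)); last first.
  by move=> i _; rewrite expr1n mulr1.
rewrite -natr_sum -mulrnA => /(congr1 (@nat_of_ord _)); rewrite val_Zp_nat //= => /eqP.
(* [N] divides twice the sum, and the factor 2 cancels because [N] is odd. *)
rewrite big_mkord -/(dvdn _ _) Gauss_dvdl ?coprimen2 // => /eqP ->.
by rewrite mod0n.
Qed.

Theorem theorem2p9 (N k : nat) (N_odd : odd N) (k_ge1 : 1 <= k) :
  let quot := min_period N k.+1 %/ min_period N k in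
  let total := \sum_(0 <= i < min_period N k) p_le k i in
  (odd k && (1 < gcdn quot N) -> quot * total = 0 %[mod N]) /\
  (~~ (odd k && (1 < gcdn quot N)) -> total = 0 %[mod N]).
Proof.
have N_gt0 := odd_gt0 N_odd.
case: k k_ge1 => // k _ quot total.
have quot_total : quot * total = 0 %[mod N] := quot_mul_sum_period N_gt0 k.
split=> // not_both; have [k_odd|k_even] := boolP (odd k.+1); last exact: sum_period_even.
move: not_both; rewrite k_odd /= -leqNgt => gcd_le1.
have co : coprime N quot.
  by rewrite coprime_sym /coprime eqn_leq gcd_le1 gcdn_gt0 N_gt0 orbT.
by move/eqP: quot_total; rewrite mod0n -/(dvdn _ _) Gauss_dvdr // => /eqP.
Qed.
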